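(* There is a function $\eta:\mathbb N\to\mathbb R$ with $\eta(n)\to 0$ as $n\to\infty$ such that for every positive integer $n$ and every $n$-uniform maximal intersecting family $\mathcal F$ we have $$|\mathcal F|\le e^{-n^{1/2+\eta(n)}}\, n^n .$$
   Context: A family $\mathcal F$ of finite sets is intersecting if any two of its members have non-empty intersection, and $n$-uniform if every member has exactly $n$ elements. An $n$-uniform intersecting family $\mathcal F$ is maximal if for every $n$-element set $F\notin\mathcal F$ the family $\mathcal F\cup\{F\}$ is not intersecting. The ground set is not fixed: $F$ may contain elements outside the union of the members of $\mathcal F$.
   Formalization: The bound is proved for every n ≥ 2 rather than every positive integer n: at n = 1 it is false for every η, since the maximal intersecting family {{a}} has size 1 > e^{-1}. *)

(* Defs.v *)
From HB Require Import structures.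
From mathcomp Require Import all_boot all_order all_algebra.
From mathcomp Require Import finmap.
From mathcomp Require Import all_classical all_reals all_analysis.

Set Implicit Arguments.
Unset Strict Implicit.
Unset Printing Implicit Defensive.

Local Open Scope classical_set_scope.

Definition uniform (K : choiceType) (n : nat) (F : set {fset K}) : Prop :=
  forall A, F A -> #|` A|%fset = n.

Definition intersecting (K : choiceType) (F : set {fset K}) : Prop :=
  forall A B, F A -> F B -> (A `&` B != fset0)%fset.

Definition maximal_intersecting (K : choiceType) (n : nat)
    (F : set {fset K}) : Prop :=
  [/\ uniform n F,
      intersecting F
    & forall G : {fset K}, #|` G|%fset = n -> ~ F G ->
        ~ intersecting (F `|` [set G])].

Definition covered (K : choiceType) (F : set {fset K}) : set K :=
  \bigcup_(A in F) [set` A].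

(* The ground set is not fixed: an n-set that is tested against F may use points
   outside the union of F. A type K models this when it has such points to
   spare, as it does for every finite F over an infinite K. Without them, the
   n-sets of an infinite K through a given point would form an infinite maximal
   family when 1 < n. *)
Definition spare_points (K : choiceType) (F : set {fset K}) : Prop :=
  infinite_set (~` covered F).

(* Main.v *)
Require Import Defs.
From HB Require Import structures.
From mathcomp Require Import all_boot all_order all_algebra.
From mathcomp Require Import finmap.
From mathcomp Require Import all_classical all_reals all_analysis.
From mathcomp Require Import ring lra zify.

Set Implicit Arguments.
Unset Strict Implicit.
Unset Printing Implicit Defensive.

Import Order.TTheory GRing.Theory Num.Theory.
Import numFieldNormedType.Exports.

Local Open Scope classical_set_scope.
Local Open Scope ring_scope.

(* A set X with fewer than n elements misses some member of F: otherwise X,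
   completed to an n-set by spare points, could be added to F. Branching over
   the points of such a member gives |F(X)| <= n^(n-|X|), where F(X) is the set
   of members of F containing X, and in particular |F| <= n^n.

   To gain on this, let A_1, ..., A_j be members of F that miss X and let P be
   the set of points lying in at least two of them. A member of F(X) either
   contains a point of P, or contains one point from each of the disjoint sets
   A_i \ P. With d = |P|/n, and since every point of P lies in two of the A_i,
   this improves the trivial bound by the factor
   d + prod_i |A_i \ P|/n <= d + exp(-2d), which is at most exp(-d/2) for
   d <= 1/6, at the cost of enlarging X by at most j points.

   Let r be of order sqrt n and |X| < n/2. If two members A, B missing X have
   r <= |A /\ B| <= n - r, they already give a factor exp(-r/(8n)) per point.
   Otherwise, choose the A_i greedily so that A_i misses X, the current P and r
   points of each previous A_k; then 1 <= |A_i /\ A_k| < r, so P grows by at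
   least i-1 and at most r(i-1) points in step i. Stopping as soon as
   |P| >= rj/4 again yields a factor exp(-r/(8n)) per point. Since this can be
   continued until |X| = n/2, it gives |F| <= exp(-sqrt n/1024) n^n, that is,
   eta(n) = - ln 1024 / ln n. *)

(** * Finite sets: choosing subsets and bounding overlaps *)

Section FiniteSets.
Local Open Scope fset_scope.
Local Open Scope nat_scope.
Variable K : choiceType.
Implicit Types (A B P X G : {fset K}) (s : seq {fset K}).

Lemma fsubset_of_card A m : m <= #|` A| ->
  exists2 B, B `<=` A & #|` B| = m.
Proof.
elim: m => [|m IHm] mA; first by exists fset0; rewrite ?fsub0set ?cardfs0.
have [B BA cB] := IHm (ltnW mA).
have /fset0Pn[x] : A `\` B != fset0.
  by rewrite -cardfs_gt0 cardfsDS // cB subn_gt0.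
rewrite inE => /andP[xB xA]; exists (x |` B); last by rewrite cardfsU1 xB cB.
by rewrite fsubUset BA fsub1set xA.
Qed.

Lemma fset0PnI A B : A `&` B != fset0 -> exists2 x, x \in A & x \in B.
Proof. by move=> /fset0Pn[x]; rewrite inE => /andP[xA xB]; exists x. Qed.

Lemma cardfsU_disjoint A B : [disjoint A & B] -> #|` A `|` B| = #|` A| + #|` B|.
Proof. by rewrite -fsetI_eq0 => /eqP AB0; rewrite -cardfsUI AB0 cardfs0 addn0. Qed.

Lemma leq_cardfsU A B : #|` A `|` B| <= #|` A| + #|` B|.
Proof. by rewrite -cardfsUI leq_addr. Qed.

(** With [A] the next member of the greedy construction and [s] the earlier ones, these points
    become shared when [A] joins. *)
Definition meet_union A s := [fset x in A | has (fun B => x \in B) s].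

Lemma in_meet_union A s x :
  (x \in meet_union A s) = (x \in A) && has (fun B => x \in B) s.
Proof. by rewrite !inE. Qed.

Lemma meet_union_cons A B s :
  meet_union A (B :: s) = (A `&` B) `|` meet_union A s.
Proof. by apply/fsetP => x; rewrite !inE /= andb_orr. Qed.

Lemma leq_meet_union A s : #|` meet_union A s| <= \sum_(B <- s) #|` A `&` B|.
Proof.
elim: s => [|B s IHs].
  rewrite big_nil leqn0 cardfs_eq0; apply/eqP/fsetP => x.
  by rewrite in_meet_union andbF inE.
by rewrite big_cons meet_union_cons (leq_trans (leq_cardfsU _ _)) // leq_add2l.
Qed.

(** As [A] avoids [P], it meets the sets of [s] in their pairwise disjoint parts outside [P], hence
    in distinct points. *)
Lemma size_leq_meet_union A P s :
  [disjoint A & P] -> {in s, forall B, A `&` B != fset0} ->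
  pairwise (fun B C => [disjoint B `\` P & C `\` P]) s ->
  size s <= #|` meet_union A s|.
Proof.
move=> AP; elim: s => // B s IHs hit /= /andP[/allP dB ps].
rewrite meet_union_cons cardfsU_disjoint; last first.
  apply/fdisjointP => x; rewrite inE => /andP[xA xB].
  rewrite in_meet_union xA /=; apply/hasPn => C Cs; apply/negP => xC.
  have xP := fdisjointP AP _ xA.
  by have /fdisjointP /(_ x) := dB _ Cs; rewrite !inE xP xB xC => /(_ isT).
have := hit B (mem_head _ _); rewrite -cardfs_gt0 => B0.
suff : size s <= #|` meet_union A s| by move: B0; clear; lia.
by apply: IHs => // C Cs; apply: hit; rewrite inE Cs orbT.
Qed.

(** Take [r] points of each set. A set avoiding [Q] then meets each [n]-set of [s] in at most
    [n - r] points. *)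
Lemma fset_meeting_all r s : {in s, forall B, r <= #|` B|} ->
  exists2 Q, #|` Q| <= r * size s & {in s, forall B, r <= #|` B `&` Q|}.
Proof.
elim: s => [|B s IHs] rs; first by exists fset0; rewrite ?cardfs0.
have [|Q cQ sQ] := IHs; first by move=> C Cs; apply: rs; rewrite inE Cs orbT.
have [T TB cT] := fsubset_of_card (rs _ (mem_head _ _)).
exists (T `|` Q).
  by rewrite (leq_trans (leq_cardfsU _ _)) //= cT mulnS leq_add2l.
move=> C; rewrite inE => /orP[/eqP->|Cs].
  by rewrite -{1}cT fsubset_leq_card // fsubsetI TB fsubsetUl.
by rewrite (leq_trans (sQ _ Cs)) // fsubset_leq_card // fsetIS // fsubsetUr.
Qed.

End FiniteSets.

(** * Counting members by branching *)

Section Counting.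
Local Open Scope fset_scope.
Local Open Scope nat_scope.
Variables (K : choiceType) (FF : {fset {fset K}}) (n : nat).
Implicit Types (A B P X G : {fset K}) (s : seq {fset K}).

(** [deg X fset0] is |F(X)|; the avoided set [B] singles out members without shared points. *)
Definition deg X B := \sum_(G <- FF) ((X `<=` G) && [disjoint G & B]%fset).

Hypothesis uniformF : {in FF, forall A, #|` A| = n}.
Hypothesis intersF : {in FF &, forall A B, A `&` B != fset0}.
Hypothesis coverF : forall X, #|` X| < n ->
  exists2 A, A \in FF & [disjoint A & X].
Hypothesis n_gt0 : 0 < n.

Lemma deg00 : deg fset0 fset0 = #|` FF|.
Proof.
rewrite /deg (eq_bigr (fun=> 1)) ?sum1_size // => G _.
by rewrite fsub0set fdisjointX0.
Qed.

Lemma leq_fset_sum (T : choiceType) (c : T -> nat) (I : {fset T}) x : x \in I ->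
  c x <= \sum_(i <- I) c i.
Proof. by move=> xI; rewrite (big_fsetD1 x) //= leq_addr. Qed.

(** Each member counted meets [A], necessarily outside [B]; charge it to such a point. *)
Lemma deg_branch X B A : A \in FF ->
  deg X B <= \sum_(x <- A `\` B) deg (x |` X) B.
Proof.
move=> AF; rewrite /deg exchange_big /= big_seq [leqRHS]big_seq.
apply: leq_sum => G GF; case: andP => // -[XG GB].
have [x xA xG] := fset0PnI (intersF AF GF).
have xB := fdisjointP GB _ xG.
apply: leq_trans (leq_fset_sum (fun x => nat_of_bool ((x |` X `<=` G) && _)) (x := x) _).
  by rewrite fsubUset fsub1set xG XG GB.
by rewrite inE xB.
Qed.

Lemma deg_split X P :
  deg X fset0 <= \sum_(p <- P) deg (p |` X) fset0 + deg X P.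
Proof.
rewrite /deg exchange_big /= -big_split /= big_seq [leqRHS]big_seq.
apply: leq_sum => G GF; rewrite fdisjointX0 andbT; case: (boolP (X `<=` G)) => //= XG.
case: (boolP [disjoint G & P]%fset) => [|GP]; first by rewrite addn1.
have /fset0PnI[p pG pP] : G `&` P != fset0 by rewrite fsetI_eq0.
rewrite addn0.
apply: leq_trans (leq_fset_sum (fun x => nat_of_bool ((x |` X `<=` G) && _)) (x := p) _).
  by rewrite fsubUset fsub1set pG XG.
exact: pP.
Qed.

Lemma deg_anti X B : deg X B <= deg X fset0.
Proof.
by apply: leq_sum => G _; rewrite fdisjointX0 andbT; case: (X `<=` G); case: fdisjoint.
Qed.

Lemma deg_trivial X : #|` X| <= n -> deg X fset0 <= n ^ (n - #|` X|).
Proof.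
move=> Xn; have [m] := ubnP (n - #|` X|); elim: m X Xn => // m IHm X Xn mX.
have [Xn'|nX] := ltnP #|` X| n.
  have [A AF AX] := coverF Xn'.
  apply: leq_trans (deg_branch _ _ AF) _; rewrite fsetD0.
  apply: (@leq_trans (\sum_(x <- A) n ^ (n - #|` X|).-1)).
    rewrite big_seq [leqRHS]big_seq; apply: leq_sum => x xA.
    have cX : #|` x |` X| = #|` X|.+1 by rewrite cardfsU1 (fdisjointP AX).
    have -> : (n - #|` X|).-1 = n - #|` x |` X| by rewrite cX; clear -Xn'; lia.
    by apply: IHm; rewrite cX; clear -Xn' mX; lia.
  rewrite big_const_seq count_predT iter_addn_0 (uniformF AF) mulnC -expnS.
  by rewrite prednK // subn_gt0.
have -> : n - #|` X| = 0 by clear -nX; lia.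
rewrite expn0 /deg.
have [XF|XF] := boolP (X \in FF).
  rewrite (big_fsetD1 X) //= big_seq big1 ?addn0; first by case: (_ && _).
  move=> G; rewrite !inE => /andP[GX GF]; case: andP => // -[XG _].
  case/eqP: GX; apply/eqP; rewrite eq_sym eqEfcard XG.
  by rewrite uniformF.
rewrite big_seq big1 // => G GF; case: andP => // -[XG _].
case/negP: XF; have -> // : X = G.
by apply/eqP; rewrite eqEfcard XG uniformF.
Qed.

(** * Branching with a weight for later gains *)

Section Weights.
Local Open Scope ring_scope.
Variable R : realType.

Lemma natr_sum_le (I : {fset K}) (f : K -> nat) (c : R) :
  {in I, forall x, (f x)%:R <= c} ->
  (\sum_(x <- I) f x)%:R <= #|` I|%:R * c.
Proof.
move=> fc; rewrite natr_sum big_seq.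
apply: le_trans (_ : \sum_(x <- I | x \in I) c <= _).
  by apply: ler_sum => x; apply: fc.
by rewrite -big_seq big_const_seq count_predT iter_addr_0 mulr_natl.
Qed.

(** Branch over the members of [s] in turn: the sets counted avoid [P], so each [A] offers only the
    points of [A] outside [P]. *)
Lemma deg_prod (w : R) X s P :
  {in s, forall A, A \in FF /\ [disjoint A & X]%fset} ->
  pairwise (fun B C => [disjoint B `\` P & C `\` P]%fset) s ->
  (#|` X| + size s <= n)%N ->
  (forall Y, #|` Y| = (#|` X| + size s)%N ->
    (deg Y fset0)%:R <= n%:R ^+ (n - #|` Y|) * w) ->
  (deg X P)%:R <=
    n%:R ^+ (n - #|` X|) * w * \prod_(A <- s) (#|` A `\` P|%:R / n%:R).
Proof.
elim: s X => [|A s IHs] X sF /= => [_ Xn degY|/andP[/allP dA ps] Xn degY].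
  rewrite big_nil mulr1; apply: le_trans (degY X (esym (addn0 _))).
  by rewrite ler_nat deg_anti.
have [AF AX] := sF _ (mem_head _ _).
have cX x : x \in A -> #|` x |` X| = #|` X|.+1.
  by move=> xA; rewrite cardfsU1 (fdisjointP AX).
apply: le_trans (_ : (\sum_(x <- A `\` P) deg (x |` X) P)%:R <= _).
  by rewrite ler_nat deg_branch.
pose c := n%:R ^+ (n - #|` X|).-1 * w * \prod_(B <- s) (#|` B `\` P|%:R / n%:R).
apply: (le_trans (natr_sum_le (c := c) _)) => [x|].
  rewrite inE => /andP[xP xA].
  rewrite /c; have -> : (n - #|` X|).-1 = (n - #|` x |` X|)%N.
    by rewrite cX // subnS.
  apply: IHs => //; rewrite ?cX ?addSnnS //.
  (* Disjointness outside [P] keeps the remaining members disjoint from the enlarged [X]. *)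
  move=> B Bs; have [|BF BX] := sF B; first by rewrite inE Bs orbT.
  split=> //; rewrite fdisjointXU BX andbT fdisjointX1.
  have /fdisjointP/(_ x) := dA _ Bs; rewrite !inE xP xA => /(_ isT).
  by rewrite andTb.
have nX : (n - #|` X|)%N = (n - #|` X|).-1.+1 by clear -Xn; lia.
rewrite /c big_cons [in leRHS]nX exprS.
have n0 : n%:R != 0 :> R by rewrite pnatr_eq0 -lt0n.
rewrite le_eqVlt; apply/orP; left; apply/eqP; field.
by apply/n0.
Qed.

(** The last clause keeps [P] disjoint from [X], so that adding a point of [P] really enlarges
    [X]. *)
Definition chain X s P :=
  [/\ {in s, forall A, A \in FF /\ [disjoint A & X]%fset},
      pairwise (fun B C => [disjoint B `\` P & C `\` P]%fset) s
    & {in P, forall x, has (fun B => x \in B) s}].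

(** Sets meeting [P] are charged to one new point, the others to [size s] new points, whence the
    range of sizes in the hypothesis on [w]. *)
Lemma deg_step (w : R) X s P : chain X s P ->
  (0 < size s)%N -> (#|` X| + size s <= n)%N ->
  (forall Y, (#|` X| < #|` Y| <= #|` X| + size s)%N ->
    (deg Y fset0)%:R <= n%:R ^+ (n - #|` Y|) * w) ->
  (deg X fset0)%:R <= n%:R ^+ (n - #|` X|) * w *
    (#|` P|%:R / n%:R + \prod_(A <- s) (#|` A `\` P|%:R / n%:R)).
Proof.
move=> [sF ps Ps] s0 Xn degY; rewrite mulrDr.
apply: le_trans
  (_ : (\sum_(p <- P) deg (p |` X) fset0)%:R + (deg X P)%:R <= _).
  by rewrite -natrD ler_nat deg_split.
apply: lerD; last first.
  by apply: deg_prod => // Y cY; apply: degY; rewrite cY; clear -s0; lia.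
apply: (le_trans (natr_sum_le (c := n%:R ^+ (n - #|` X|).-1 * w) _)) => [x xP|].
  have /hasP[B Bs xB] := Ps _ xP; have [_ BX] := sF _ Bs.
  have cX : #|` x |` X| = #|` X|.+1 by rewrite cardfsU1 (fdisjointP BX).
  have -> : (n - #|` X|).-1 = (n - #|` x |` X|)%N by rewrite cX // subnS.
  by apply: degY; rewrite cX; clear -s0; lia.
have nX : (n - #|` X|)%N = (n - #|` X|).-1.+1 by clear -Xn s0; lia.
rewrite [in leRHS]nX exprS.
have n0 : n%:R != 0 :> R by rewrite pnatr_eq0 -lt0n.
by rewrite le_eqVlt; apply/orP; left; apply/eqP; field; apply/n0.
Qed.

End Weights.

(** * Chains of overlapping members *)

Lemma chain_pair X A B : A \in FF -> B \in FF ->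
  [disjoint A & X] -> [disjoint B & X] -> chain X [:: A; B] (A `&` B).
Proof.
move=> AF BF AX BX; split.
- by move=> C; rewrite !inE => /orP[] /eqP ->.
- rewrite /= !andbT; apply/fdisjointP => x.
  by rewrite !inE; case: (x \in A); case: (x \in B).
- by move=> x; rewrite inE => /andP[xA _]; rewrite /= xA.
Qed.

(* Double counting: it holds as soon as every point of P lies in two sets of s. *)
Definition overlap_heavy s P := 2 * #|` P| <= \sum_(A <- s) #|` A `&` P|.

(** Each point of [N] lies in [A] and in an earlier set, so it adds at least 2 to the overlap
    sum. *)
Lemma chain_add X s P A : chain X s P -> overlap_heavy s P ->
  A \in FF -> [disjoint A & X `|` P] ->
  let N := meet_union A s in
  [/\ chain X (A :: s) (P `|` N), overlap_heavy (A :: s) (P `|` N),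
      #|` P `|` N| = #|` P| + #|` N| & size s <= #|` N|].
Proof.
move=> [sF ps Ps] hP AF; rewrite fdisjointXU => /andP[AX AP] N.
have NA : N `<=` A by apply/fsubsetP => x; rewrite in_meet_union => /andP[].
have NP : [disjoint P & N].
  by rewrite fdisjoint_sym (fdisjointWl NA).
have cPN := cardfsU_disjoint NP.
split=> //.
- split.
  + by move=> B; rewrite inE => /orP[/eqP->//|]; apply: sF.
  + rewrite /=; apply/andP; split.
      apply/allP => B Bs; apply/fdisjointP => x; rewrite !in_fsetD !in_fsetU.
      rewrite negb_or -andbA => /and3P[xP xN xA].
      rewrite (negPf xP) (negPf xN) /=; apply/negP => xB.
      by case/negP: xN; rewrite in_meet_union xA; apply/hasP; exists B.
    apply: sub_pairwise ps => B C /fdisjointP BC; apply/fdisjointP => x.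
    rewrite !in_fsetD !in_fsetU !negb_or -andbA => /and3P[xP xN xB].
    have := BC x; rewrite !in_fsetD xP xB (negPf xN) => /(_ isT).
    by rewrite ?xP.
  + move=> x; rewrite in_fsetU in_meet_union /= => /orP[/Ps->|/andP[->]//].
    by rewrite orbT.
- rewrite /overlap_heavy big_cons cPN.
  have cA : #|` N| <= #|` A `&` (P `|` N)|.
    by rewrite fsubset_leq_card // fsubsetI NA fsubsetUr.
  have cs : \sum_(B <- s) #|` B `&` P| + \sum_(B <- s) #|` A `&` B| <=
            \sum_(B <- s) #|` B `&` (P `|` N)|.
    rewrite -big_split /= big_seq [leqRHS]big_seq; apply: leq_sum => B Bs.
    rewrite -cardfsU_disjoint.
      apply: fsubset_leq_card; apply/fsubsetP => x.
      rewrite !in_fsetU !in_fsetI !in_fsetU in_meet_union.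
      case/orP => /andP[xB xP]; first by rewrite xB xP.
      by rewrite xB xP /=; apply/orP; right; apply/hasP; exists B.
    apply/fdisjointP => x; rewrite !in_fsetI => /andP[_ xP]; apply/negP.
    by move=> /andP[xA _]; move: (fdisjointP AP _ xA); rewrite xP.
  have cN := leq_meet_union A s; rewrite -/N in cN.
  by move: hP; rewrite /overlap_heavy; clear -cA cs cN; lia.
- apply: size_leq_meet_union AP _ ps => B Bs.
  by apply: intersF => //; have [] := sF _ Bs.
Qed.

(** If the greedy construction never stopped, it would reach [r] members with r(r-1) <= 2|P| and
    4|P| < r^2, impossible for r > 1. *)
Lemma exists_chain r X : 1 < r -> 16 * r ^ 2 <= n -> #|` X| < n./2 ->
  {in FF &, forall A B, [disjoint A & X] -> [disjoint B & X] ->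
    #|` A `&` B| < r \/ n - r < #|` A `&` B|} ->
  exists s P, [/\ chain X s P, overlap_heavy s P, 0 < size s <= r,
    r * size s <= 4 * #|` P| & #|` P| <= 2 * r ^ 2].
Proof.
move=> r1 rn Xn dich; apply: contrapT => no_good.
have nhalf : n./2.*2 <= n by rewrite -{2}(odd_double_half n) leq_addl.
have step j : 0 < j <= r -> exists s P, [/\ chain X s P,
    overlap_heavy s P, size s = j, 4 * #|` P| < r * j & j * j.-1 <= 2 * #|` P|].
  elim: j => // -[_ _|j IHj jr].
    have [|A AF AX] := @coverF X; first by clear -Xn nhalf; lia.
    exists [:: A], fset0; split=> //.
    - by split=> // B; rewrite inE => /eqP->.
    - by rewrite cardfs0 muln1 muln0; clear -r1; lia.
  have [|s [P [ch hP sj Pj jP]]] := IHj; first by clear -jr; lia.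
  have [sF ps Ps] := ch.
  have rn' : r <= n by clear -rn r1; nia.
  have [|Q cQ sQ] := @fset_meeting_all _ r s.
    by move=> B Bs; have [BF _] := sF _ Bs; rewrite uniformF.
  (* There is room: |X| < n/2, |P| < r^2/4 and |Q| <= r^2 <= n/16. Avoiding [Q] rules out the large
     intersections in [dich]. *)
  have [|A AF AZ] := @coverF (X `|` P `|` Q).
    apply: leq_ltn_trans (leq_cardfsU _ _) _.
    have := leq_cardfsU X P; rewrite sj in cQ.
    have : r * j.+1 <= r ^ 2 by rewrite -mulnn leq_mul2l; clear -jr; lia.
    by clear -Pj cQ rn Xn nhalf; nia.
  move: AZ; rewrite fdisjointXU => /andP[AXP AQ].
  have AX : [disjoint A & X].
    by move: AXP; rewrite fdisjointXU => /andP[].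
  have [ch' hP' cP' sN] := chain_add ch hP AF AXP.
  set N := meet_union A s in ch' hP' cP' sN.
  have Nr : #|` N| <= r * j.+1.
    rewrite -sj (leq_trans (leq_meet_union _ _)) // mulnC.
    have -> : size s * r = \sum_(B <- s) r.
      by rewrite big_const_seq count_predT iter_addn_0 mulnC.
    rewrite big_seq [leqRHS]big_seq; apply: leq_sum => B Bs.
    have [BF BX] := sF _ Bs; have [/ltnW//|] := dich A B AF BF AX BX.
    have := sQ _ Bs.
    have : #|` A `&` B| + #|` B `&` Q| <= n.
      rewrite -(uniformF BF) -cardfsU_disjoint.
        by rewrite fsubset_leq_card // fsubUset fsubsetIr fsubsetIl.
      apply/fdisjointP => x; rewrite !in_fsetI => /andP[xA _].
      by rewrite (negPf (fdisjointP AQ _ xA)) andbF.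
    by clear; lia.
  have [le4|gt4] := leqP (r * j.+2) (4 * #|` P `|` N|).
    (* At the first crossing the old |P| is below r^2/4 and |N| <= r^2. *)
    case: no_good; exists (A :: s), (P `|` N); split=> //=; rewrite ?sj //.
    rewrite cP'; have : r * j.+2 <= r ^ 2 by rewrite -mulnn leq_mul2l; clear -jr; lia.
    by clear -Pj Nr; nia.
  exists (A :: s), (P `|` N); split=> //=; first by rewrite sj.
  by rewrite cP' /=; move: jP sN; rewrite sj /=; clear; nia.
have [|s [P [_ _ _ h1 h2]]] := step r; first by rewrite leqnn andbT ltnW.
by clear -h1 h2 r1; nia.
Qed.

(** * From overlaps to exponential gains *)

Section Gains.
Local Open Scope ring_scope.
Variable R : realType.

Let n0 : 0 < n%:R :> R. Proof. by rewrite ltr0n. Qed.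

Lemma card_ratio A P : A \in FF ->
  #|` A `\` P|%:R / n%:R = 1 - #|` A `&` P|%:R / n%:R :> R.
Proof.
move=> AF; have := cardfsID P A; rewrite (uniformF AF) => /(congr1 (fun k => k%:R : R)).
rewrite natrD => e; apply/eqP; rewrite eq_sym subr_eq -mulrDl addrC e.
by rewrite divff // gt_eqF.
Qed.

(** For two members sharing dn points, [deg_step] gives d + (1-d)^2 = 1 - d(1-d). *)
Lemma pair_gain (w : R) X A B : A \in FF -> B \in FF ->
  [disjoint A & X]%fset -> [disjoint B & X]%fset -> (#|` X| + 2 <= n)%N ->
  (forall Y, (#|` X| < #|` Y| <= #|` X| + 2)%N ->
    (deg Y fset0)%:R <= n%:R ^+ (n - #|` Y|) * w) ->
  (deg X fset0)%:R <= n%:R ^+ (n - #|` X|) * w *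
    (1 - #|` A `&` B|%:R / n%:R * (1 - #|` A `&` B|%:R / n%:R)).
Proof.
move=> AF BF AX BX Xn degY.
have ch := chain_pair AF BF AX BX.
apply: le_trans (deg_step ch _ Xn degY) _ => //.
rewrite !big_cons big_nil !card_ratio //.
rewrite fsetIA fsetIid (fsetIC A B) fsetIA fsetIid (fsetIC B A).
by rewrite le_eqVlt; apply/orP; left; apply/eqP; ring.
Qed.

Lemma prod_ratio s P : {in s, forall A, A \in FF} ->
  \prod_(A <- s) (#|` A `\` P|%:R / n%:R) <=
  expR (- ((\sum_(A <- s) #|` A `&` P|)%:R / n%:R)) :> R.
Proof.
elim: s => [|A s IHs] sF; first by rewrite !big_nil mul0r oppr0 expR0.
rewrite !big_cons natrD mulrDl opprD expRD; apply: ler_pM.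
- by rewrite divr_ge0.
- by apply: prodr_ge0 => B _; rewrite divr_ge0.
- by rewrite card_ratio ?expR_ge1Dx // sF ?mem_head.
- by apply: IHs => B Bs; rewrite sF // inE Bs orbT.
Qed.

(** By exp(-2d) <= 1/(1+2d) and 1 - d/2 <= exp(-d/2), it suffices that 1 <= (1 - 3d/2)(1 + 2d),
    which is where 1/6 comes from. *)
Lemma half_gain (d : R) : 0 <= d -> d <= 1 / 6 ->
  d + expR (- (2 * d)) <= expR (- (d / 2)).
Proof.
move=> d0 d6; apply: le_trans (expR_ge1Dx _).
have e1 := expR_ge1Dx (2 * d); have e0 := expR_gt0 (- (2 * d)).
have := expRxMexpNx_1 (2 * d).
set x := expR (2 * d) in e1 *; set y := expR _ in e0 *.
nra.
Qed.

Lemma chain_gain X s P : chain X s P -> overlap_heavy s P ->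
  (6 * #|` P| <= n)%N ->
  #|` P|%:R / n%:R + \prod_(A <- s) (#|` A `\` P|%:R / n%:R) <=
  expR (- (#|` P|%:R / n%:R / 2)) :> R.
Proof.
move=> [sF _ _]; rewrite /overlap_heavy -(ler_nat R) -(ler_nat R) !natrM => hP Pn.
have d6 : #|` P|%:R / n%:R <= 1 / 6 :> R.
  by rewrite ler_pdivrMr //; lra.
apply: le_trans (half_gain _ d6); rewrite ?divr_ge0 //.
rewrite lerD2l; apply: le_trans (prod_ratio _ _) _ => [A /sF[]//|].
by rewrite ler_expR lerN2 mulrA ler_pM2r // invr_gt0.
Qed.

Lemma deg_decay r X : (1 < r)%N -> (16 * r ^ 2 <= n)%N -> (#|` X| <= n)%N ->
  (deg X fset0)%:R <= n%:R ^+ (n - #|` X|) *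
    expR (- (r%:R / (8 * n%:R))) ^+ (n./2 - #|` X|) :> R.
Proof.
move=> r1 rn; set q : R := expR _.
have q0 : 0 <= q := expR_ge0 _.
have q1 : q <= 1 by rewrite -expR0 ler_expR oppr_le0 divr_ge0 // mulr_ge0.
have [m] := ubnP (n - #|` X|); elim: m X => // m IHm X mX Xn.
have [nX|Xh] := leqP n./2 #|` X|.
  rewrite (eqP (nX : _ == _)) expr0 mulr1 -natrX ler_nat.
  exact: deg_trivial.
have nhalf : (n./2.*2 <= n)%N by rewrite -{2}(odd_double_half n) leq_addl.
(* Feeds the induction hypothesis into one gain step; as [q <= 1], a single weight serves all sizes
   up to |X| + j. *)
have reduce j g : (0 < j <= r)%N -> g <= q ^+ j ->
  (forall w, (forall Y, (#|` X| < #|` Y| <= #|` X| + j)%N ->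
      (deg Y fset0)%:R <= n%:R ^+ (n - #|` Y|) * w) ->
    (deg X fset0)%:R <= n%:R ^+ (n - #|` X|) * w * g) ->
  (deg X fset0)%:R <= n%:R ^+ (n - #|` X|) * q ^+ (n./2 - #|` X|).
  move=> jr gq degX; apply: le_trans (degX (q ^+ (n./2 - #|` X| - j)) _) _.
    move=> Y XY; apply: le_trans (IHm Y _ _) _.
    - by clear -XY mX Xh nhalf; lia.
    - by clear -XY Xh nhalf jr r1 rn; nia.
    - by rewrite ler_wpM2l ?exprn_ge0 // ler_wiXn2l //; clear -XY; lia.
  rewrite -mulrA ler_wpM2l ?exprn_ge0 //.
  apply: le_trans (_ : q ^+ (n./2 - #|` X| - j) * q ^+ j <= _).
    by rewrite ler_wpM2l ?exprn_ge0.
  (* Truncated subtraction can only increase the total exponent, which is harmless as [q <= 1]. *)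
  by rewrite -exprD ler_wiXn2l //; clear; lia.
have [[A [B [AF BF AX BX /andP[rAB ABr]]]]|sep] := pselect (exists A B,
    [/\ A \in FF, B \in FF, [disjoint A & X]%fset, [disjoint B & X]%fset
      & (r <= #|` A `&` B| <= n - r)%N]).
  apply: (reduce 2 _ _ _ (fun w => pair_gain AF BF AX BX _)) => //.
    (* With p = r/n <= 1/2 and p <= d <= 1-p, d(1-d) is at least p/2, while q^2 asks only for
       p/4. *)
    apply: le_trans (expR_ge1Dx _) _; rewrite -expRM_natl ler_expR.
    set d := #|` A `&` B|%:R / n%:R.
    have hd1 : r%:R / n%:R <= d by rewrite ler_pM2r ?invr_gt0 // ler_nat.
    have hd2 : d <= 1 - r%:R / n%:R.
      rewrite -{1}(divff (lt0r_neq0 n0)) -mulrBl ler_pM2r ?invr_gt0 //.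
      by rewrite lerBrDr -natrD ler_nat; move: ABr rn r1; clear; nia.
    have hr : r%:R / n%:R <= 1 / 2 :> R.
      rewrite ler_pdivrMr // mulrAC mul1r ler_pdivlMr // -natrM ler_nat.
      by move: rn r1; clear; nia.
    have -> : r%:R / (8 * n%:R) = r%:R / n%:R / 8 :> R by rewrite invfM mulrA mulrAC.
    have r0 : 0 <= r%:R / n%:R :> R by rewrite divr_ge0.
    by set p := r%:R / n%:R in hd1 hd2 hr r0 *; nra.
  by move: Xh nhalf rn r1; clear; nia.
have [A B AF BF AX BX|s [P [ch hP /andP[s0 sr] rP Pr]]] := exists_chain r1 rn Xh.
  case: (ltnP #|` A `&` B| r) => rAB; [by left|right; rewrite ltnNge].
  by apply/negP => ABr; apply: sep; exists A, B; split; rewrite // rAB ABr.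
have P6 : (6 * #|` P| <= n)%N by move: Pr rn r1; clear; nia.
apply: (reduce (size s) _ _ _ (fun w => deg_step ch s0 _)).
- by rewrite s0 sr.
(* |P| >= r|s|/4 turns exp(-|P|/(2n)) into q^|s|, hence the 8 in [q]. *)
- apply: le_trans (chain_gain ch hP P6) _; rewrite -expRM_natl ler_expR.
  have : (r * size s)%:R <= (4 * #|` P|)%:R :> R by rewrite ler_nat.
  rewrite !natrM => rsP; rewrite mulrN lerN2 invfM.
  have -> : (size s)%:R * (r%:R * (8^-1 / n%:R)) = r%:R * (size s)%:R / 8 / n%:R :> R by ring.
  by rewrite [in leRHS]mulrAC ler_pM2r ?invr_gt0 //; lra.
- by move: Xh nhalf rn r1 sr; clear; nia.
Qed.

(** Serves n < 64, where no r >= 2 has 16r^2 <= n. Two distinct members share between 1 and n-1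
    points, so d(1-d) >= 1/(2n). *)
Lemma card_near_trivial : (1 < n)%N ->
  #|` FF|%:R <= expR (- (1 / (2 * n%:R))) * n%:R ^+ n :> R.
Proof.
move=> n1; have [|A AF _] := @coverF fset0; first by rewrite cardfs0.
have /fset0Pn[x xA] : A != fset0 by rewrite -cardfs_gt0 (uniformF AF).
have [|B BF Bx] := @coverF [fset x]; first by rewrite cardfs1.
rewrite fdisjointX1 in Bx.
have AB0 := intersF AF BF; rewrite -cardfs_gt0 in AB0.
have ABn : (#|` A `&` B| < n)%N.
  rewrite -(uniformF AF) (cardfsD1 x A) xA ltnS fsubset_leq_card //.
  apply/fsubsetP => y; rewrite !inE => /andP[-> yB]; rewrite andbT.
  by apply: contraNneq Bx => <-.
have := @pair_gain 1 fset0 A B AF BF; rewrite !fdisjointX0 cardfs0 subn0 !mulr1.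
rewrite deg00 => /(_ isT isT n1) H.
apply: le_trans (H _) _.
  move=> Y /andP[_ Y2]; rewrite mulr1 -natrX ler_nat.
  by apply: deg_trivial (leq_trans Y2 n1).
rewrite mulrC ler_wpM2r ?exprn_ge0 //.
apply: le_trans (expR_ge1Dx _) _; rewrite ler_expR lerN2 invfM.
set d := #|` A `&` B|%:R / n%:R.
have hd1 : n%:R^-1 <= d by rewrite -[leLHS]mul1r ler_pM2r ?invr_gt0 // ler1n.
have hd2 : d <= 1 - n%:R^-1.
  rewrite -{1}(divff (lt0r_neq0 n0)) -[X in _ - X]mul1r -mulrBl.
  by rewrite ler_pM2r ?invr_gt0 // lerBrDr natr1 ler_nat.
have hr : n%:R^-1 <= 1 / 2 :> R by rewrite mul1r lef_pV2 ?posrE // ler_nat.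
have r0 : 0 <= n%:R^-1 :> R by rewrite invr_ge0.
by set p := n%:R^-1 in hd1 hd2 hr r0 *; nra.
Qed.

Lemma card_family_bound : (1 < n)%N ->
  #|` FF|%:R <= expR (- (Num.sqrt n%:R / 1024)) * n%:R ^+ n :> R.
Proof.
move=> n1; have sq0 := sqrtr_ge0 (n%:R : R).
have sqE : Num.sqrt n%:R ^+ 2 = n%:R :> R by rewrite sqr_sqrtr.
set x := Num.sqrt _ in sq0 sqE *.
(* For small n the bound needs n sqrt(n) <= 512 = 8 * 64; the constant 1024 is twice this. *)
have [n64|n64] := ltnP n 64.
  apply: le_trans (card_near_trivial n1) _.
  rewrite ler_wpM2r ?exprn_ge0 // ler_expR lerN2.
  have x8 : x <= 8.
    by rewrite -(ler_pXn2r (n := 2)) ?nnegrE // sqE -natrX ler_nat ltnW.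
  have n2 : 0 < 2 * n%:R :> R by rewrite mulr_gt0.
  rewrite (ler_pdivlMr _ _ n2).
  have xn : x * n%:R <= 8 * 64 by rewrite ler_pM // ler_nat ltnW.
  by lra.
have ex : exists r, (16 * r ^ 2 <= n)%N by exists 0%N.
have bd r : (16 * r ^ 2 <= n)%N -> (r <= n)%N by clear; nia.
(* The largest r with 4r <= sqrt(n); as r >= 2, sqrt(n) < 4(r+1) <= 6r. *)
pose r := ex_maxn ex bd.
have [r16 rmax] : (16 * r ^ 2 <= n)%N /\ (n < 16 * r.+1 ^ 2)%N.
  rewrite /r; case: ex_maxnP => k k16 kmax; split=> //; rewrite ltnNge.
  by apply/negP => /kmax; rewrite ltnn.
have r1 : (1 < r)%N by move: rmax n64; clear; nia.
have X0 : (#|` fset0 : {fset K}| <= n)%N by rewrite cardfs0.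
have := deg_decay r1 r16 X0; rewrite deg00 cardfs0 !subn0 mulrC => /le_trans; apply.
rewrite ler_wpM2r ?exprn_ge0 // -expRM_natl ler_expR mulrN lerN2.
have hL : n%:R <= (3 * n./2)%:R :> R.
  by rewrite ler_nat; move: (odd_double_half n) n64; clear; case: odd; lia.
have hr : x <= (6 * r)%:R.
  rewrite -(ler_pXn2r (n := 2)) ?nnegrE // sqE -natrX ler_nat.
  by move: rmax r1; clear; nia.
rewrite natrM in hL; rewrite natrM in hr.
rewrite mulrA ler_pdivlMr ?mulr_gt0 //.
apply: (@le_trans _ _ (x * n%:R / 128)); first by lra.
apply: (@le_trans _ _ (6 * r%:R * (3 * n./2%:R) / 128)); last first.
  have : 0 <= r%:R * n./2%:R :> R by rewrite mulr_ge0.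
  by lra.
by rewrite ler_pM2r ?ler_pM ?invr_gt0.
Qed.
End Gains.

End Counting.

(** * Consequences of maximality *)

Section MaximalFamilies.
Local Open Scope fset_scope.
Local Open Scope nat_scope.
Variables (K : choiceType) (n : nat) (F : set {fset K}).
Hypotheses (spareF : spare_points F) (maxF : maximal_intersecting n F).
Implicit Types (A X G : {fset K}).

Lemma exists_disjoint_member X : #|` X| < n ->
  exists2 A, F A & [disjoint A & X].
Proof.
move=> Xn; apply: contrapT => hitX; have [unifF intF satF] := maxF.
have meetX A : F A -> A `&` X != fset0.
  by move=> FA; apply/negP => AX0; apply: hitX; exists A; rewrite // -fsetI_eq0.
have [B0 B0sub cB0] := infinite_set_fset (n - #|` X|)
  (infinite_setD spareF (finite_fset X)).
have [S SB0 cS] := fsubset_of_card cB0.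
have outS x : x \in S -> ~ covered F x /\ x \notin X.
  by move=> /(fsubsetP SB0)/B0sub[ncov xX]; split=> //; apply/negP.
have cG : #|` X `|` S| = n.
  rewrite cardfsU_disjoint ?cS; first by rewrite subnKC // ltnW.
  by apply/fdisjointP_sym => x /outS[].
apply: (satF (X `|` S) cG).
  (* As |X| < n, some spare point was added, so the completed set is not in [F]. *)
  move=> FG; have /fset0Pn[x xS] : S != fset0.
    by rewrite -cardfs_gt0 cS subn_gt0.
  by have [+ _] := outS x xS; apply; exists (X `|` S); rewrite //= inE xS orbT.
have meetG A : F A -> A `&` (X `|` S) != fset0.
  by move=> /meetX/fsubset_neq0; apply; rewrite fsetIS // fsubsetUl.
move=> A B [FA|->] [FB|->]; [exact: intF|exact: meetG|rewrite fsetIC; exact: meetG|].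
by rewrite fsetIid -cardfs_gt0 cG; apply: leq_ltn_trans Xn.
Qed.

(** The same branching, with finite unions for sums. [fset_set] of an infinite set is empty, so a
    cardinality bound alone would say nothing. *)
Lemma maximal_intersecting_finite : finite_set F.
Proof.
have [unifF intF _] := maxF.
suff finX X : #|` X| <= n -> finite_set [set G | F G /\ X `<=` G].
  apply: sub_finite_set (finX fset0 _); last by rewrite cardfs0.
  by move=> G FG; split=> //; rewrite fsub0set.
have [m] := ubnP (n - #|` X|); elim: m X => // m IHm X mX Xn.
have [nX|Xn'] := leqP n #|` X|.
  apply: sub_finite_set (finite_set1 X) => G [FG XG].
  by apply/eqP; rewrite eq_sym eqEfcard XG (unifF _ FG).
have [A FA AX] := exists_disjoint_member Xn'.
have finxX x : x \in A -> finite_set [set G | F G /\ x |` X `<=` G].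
  move=> xA; have cX : #|` x |` X| = #|` X|.+1 by rewrite cardfsU1 (fdisjointP AX).
  by apply: IHm; rewrite cX //; clear -mX Xn'; lia.
apply: sub_finite_set (bigcup_finite (finite_fset A) finxX) => G [FG XG].
have [x xA xG] := fset0PnI (intF _ _ FA FG).
by exists x => //; split=> //; rewrite fsubUset fsub1set xG.
Qed.

End MaximalFamilies.

(** * Absorbing the constant factor into the exponent *)

Lemma powR_half_sub_ln (R : realType) (c x : R) : 0 < c -> 1 < x ->
  x `^ (1 / 2 - ln c / ln x) = Num.sqrt x / c.
Proof.
move=> c0 x1; have x0 : 0 < x by apply: lt_trans x1.
rewrite powRD; last by rewrite (gt_eqF x0) implybT.
rewrite mul1r powR12_sqrt ?ltW //; congr (_ * _).
rewrite /powR (gt_eqF x0) mulNr divfK; last by rewrite gt_eqF // ln_gt0.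
by rewrite expRN lnK.
Qed.

Lemma cvg_ln_natr (R : realType) : ln (n%:R : R) @[n --> \oo] --> +oo.
Proof.
apply/cvgryPge => a.
have /cvgryPge/(_ (expR a)) := @cvgr_idn R.
apply: filterS => n an; have n0 : (0 : R) < n%:R by apply: lt_le_trans an; exact: expR_gt0.
by rewrite -ler_expR lnK.
Qed.

Lemma cvg_div_ln (R : realType) (c : R) : - (c / ln n%:R) @[n --> \oo] --> (0 : R).
Proof.
rewrite -oppr0 -(mulr0 c); apply: cvgN; apply: cvgM; first exact: cvg_cst.
apply/gtr0_cvgV0; last exact: cvg_ln_natr.
by near=> n; rewrite ln_gt0 // ltr1n; near: n; exact: nbhs_infty_gt.
Unshelve. all: by end_near.
Qed.

(** For n = 1 a family consisting of one singleton is maximal, but the bound would be 1/e for every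
    [eta]; hence 1 < n. *)
Theorem theorem1 (R : realType) :
  exists2 eta : nat -> R, eta n @[n --> \oo] --> (0 : R) &
    forall (n : nat) (K : choiceType) (F : set {fset K}),
      (1 < n)%N ->
      spare_points F ->
      maximal_intersecting n F ->
      finite_set F /\
      #|` fset_set F|%fset%:R
        <= expR (- (n%:R `^ (1 / 2 + eta n))) * n%:R ^+ n.
Proof.
exists (fun n => - (ln 1024 / ln n%:R)); first exact: cvg_div_ln.
move=> n K F n1 spareF maxF; have finF := maximal_intersecting_finite spareF maxF.
split; first exact: finF.
have c0 : 0 < 1024 :> R by rewrite ltr0n.
have n1R : 1 < n%:R :> R by rewrite ltr1n.
rewrite (powR_half_sub_ln c0 n1R).
have memF A : (A \in fset_set F) = (A \in F) := in_fset_set finF A.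
have [unifF intF _] := maxF; apply: card_family_bound.
- by move=> A; rewrite memF inE; exact: unifF.
- by move=> A B; rewrite !memF !inE; exact: intF.
- move=> X /(exists_disjoint_member spareF maxF)[A FA AX].
  by exists A; rewrite // memF inE.
- exact: ltnW.
- exact: n1.
Qed.
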